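(* Let $X$ be a $\delta$-hyperbolic geodesic metric space. There exists a constant $C=C(\delta)>0$ such that the following holds. Let $H$ be a group of isometries of $X$ with a finite symmetric generating set $S$. If $\ell_X(S)>28\delta$, then $H$ contains a loxodromic element $b\in S^{\le 2}$, and moreover $$d(o,bo)\ge \ell_X(S)-C$$ for some point $o\in X$.
   Context: Gromov product: $\langle x,y\rangle_o=\frac{d(x,o)+d(y,o)-d(x,y)}{2}$. A geodesic metric space $X$ is $\delta$-hyperbolic if every geodesic triangle is $\delta$-thin: for all $o,x,y\in X$ and points $p\in[o,x]$, $q\in[o,y]$ with $d(o,p)=d(o,q)\le\langle x,y\rangle_o$, one has $d(p,q)\le\delta$. $S^{\le n}=\{h\in H:d_S(1,h)\le n\}$, with $d_S$ the word metric. $\ell_x(S)=\max_{s\in S}d(x,sx)$ and $\ell_X(S)=\inf_{x\in X}\ell_x(S)$. An isometry $g$ is loxodromic if $n\mapsto g^no$ is a quasi-isometric embedding of $\mathbb Z$ into $X$ (for a proper hyperbolic space: $g$ has infinite order and exactly two fixed points in $\partial X$). *)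

(* Defs.v *)
From HB Require Import structures.
From mathcomp Require Import all_boot all_order all_algebra finmap.
From mathcomp Require Import mathcomp_extra boolp classical_sets functions.
From mathcomp Require Import cardinality reals topology metric_structure.

Set Implicit Arguments.
Unset Strict Implicit.
Unset Printing Implicit Defensive.

Import Order.TTheory GRing.Theory Num.Theory.

Local Open Scope classical_set_scope.
Local Open Scope ring_scope.

(** ** Hyperbolic geodesic spaces *)

Definition gromov_product (R : realType) (X : metricType R) (x y o : X) : R :=
  (mdist x o + mdist y o - mdist x y) / 2.

Definition is_geodesic (R : realType) (X : metricType R) (x y : X)
    (c : R -> X) : Prop :=
  [/\ c 0 = x, c (mdist x y) = y &
    {in `[0, mdist x y] &, forall s t, mdist (c s) (c t) = `|s - t|}].

Definition geodesic_segment (R : realType) (X : metricType R) (x y : X)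
    (A : set X) : Prop :=
  exists2 c, is_geodesic x y c & A = c @` `[0, mdist x y].

Definition geodesic_space (R : realType) (X : metricType R) : Prop :=
  forall x y : X, exists A, geodesic_segment x y A.

(* The third side of the triangle does not occur in the condition, and it
   always exists in a geodesic space; the condition at the other two vertices
   is obtained by permuting o, x and y. *)
Definition thin_triangles (R : realType) (X : metricType R) (delta : R) : Prop :=
  forall (o x y : X) (A B : set X),
    geodesic_segment o x A -> geodesic_segment o y B ->
  forall p q : X, A p -> B q -> mdist o p = mdist o q ->
    mdist o p <= gromov_product x y o -> mdist p q <= delta.

Definition hyperbolic_space (R : realType) (X : metricType R) (delta : R) :
    Prop :=
  geodesic_space X /\ thin_triangles X delta.

(** ** The group of isometries *)

Record isometry_of (R : realType) (X : metricType R) := Isometry {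
  isom_fun :> X -> X ;
  isom_mdist : forall x y, mdist (isom_fun x) (isom_fun y) = mdist x y ;
  isom_bij : bijective isom_fun }.

Section isometry_group.
Context {R : realType} {X : metricType R}.
Implicit Types f g : isometry_of X.

Lemma isometryP f g : f =1 g -> f = g.
Proof.
case: f g => [f fd fb] [g gd gb] /= /funext fg; subst g.
by rewrite (Prop_irrelevance fd gd) (Prop_irrelevance fb gb).
Qed.

HB.instance Definition _ := gen_eqMixin (isometry_of X).
HB.instance Definition _ := gen_choiceMixin (isometry_of X).

Definition isom_id : isometry_of X :=
  @Isometry R X id (fun _ _ => erefl) (Bijective (frefl _) (frefl _)).

Lemma isom_comp_mdist f g x y : mdist ((f \o g) x) ((f \o g) y) = mdist x y.
Proof. by rewrite /= !isom_mdist. Qed.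

Definition isom_comp f g : isometry_of X :=
  Isometry (isom_comp_mdist f g) (bij_comp (isom_bij f) (isom_bij g)).

Lemma isom_inv_ex f : exists f' : X -> X, cancel f f' /\ cancel f' f.
Proof. by case: (isom_bij f) => f' fK f'K; exists f'. Qed.

Definition isom_inv_fun f : X -> X := sval (cid (isom_inv_ex f)).

Lemma isom_funK f : cancel f (isom_inv_fun f).
Proof. by rewrite /isom_inv_fun; case: cid => ? []. Qed.

Lemma isom_inv_funK f : cancel (isom_inv_fun f) f.
Proof. by rewrite /isom_inv_fun; case: cid => ? []. Qed.

Lemma isom_inv_mdist f x y :
  mdist (isom_inv_fun f x) (isom_inv_fun f y) = mdist x y.
Proof. by rewrite -(isom_mdist f) !isom_inv_funK. Qed.

Definition isom_inv f : isometry_of X :=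
  Isometry (isom_inv_mdist f) (Bijective (isom_inv_funK f) (isom_funK f)).

Lemma isom_compA : associative isom_comp.
Proof. by move=> f g h; exact: isometryP. Qed.

Lemma isom_comp1f : left_id isom_id isom_comp.
Proof. by move=> f; exact: isometryP. Qed.

Lemma isom_compf1 : right_id isom_id isom_comp.
Proof. by move=> f; exact: isometryP. Qed.

Lemma isom_compVf : left_inverse isom_id isom_inv isom_comp.
Proof. by move=> f; apply: isometryP => x /=; rewrite isom_funK. Qed.

Lemma isom_compfV : right_inverse isom_id isom_inv isom_comp.
Proof. by move=> f; apply: isometryP => x /=; rewrite isom_inv_funK. Qed.

HB.instance Definition _ := isGroup.Build (isometry_of X)
  isom_compA isom_comp1f isom_compf1 isom_compVf isom_compfV.

Lemma isom1E x : (1%g : isometry_of X) x = x. Proof. by []. Qed.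

Lemma isomME f g x : (f * g)%g x = f (g x). Proof. by []. Qed.

Lemma isomVK f x : f (f^-1%g x) = x. Proof. exact: isom_inv_funK. Qed.

Lemma isomKV f x : f^-1%g (f x) = x. Proof. exact: isom_funK. Qed.

End isometry_group.

(** ** Generating sets and the word metric *)

Definition subgroup (G : groupType) (H : set G) : Prop :=
  group_closed (mem H).

Definition symmetric_set (G : groupType) (S : set G) : Prop :=
  forall s, S s -> S s^-1%g.

Definition generates (G : groupType) (S H : set G) : Prop :=
  smallest (@subgroup G) S = H.

Definition is_word (G : groupType) (S : set G) (n : nat) (g : G) : Prop :=
  exists w : n.-tuple G,
    {in w, forall s, S s} /\ (\big[*%g/1%g]_(s <- w) s)%g = g.

(* Meant for a symmetric S, so that words need no inverse letters. The junk
   value 0 is only taken when g^-1 * h is not in the subgroup generated by S. *)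
Definition word_dist (G : groupType) (S : set G) (g h : G) : nat :=
  if pselect (exists n, `[< is_word S n (g^-1 * h)%g >]) is left ex
  then ex_minn ex else 0%N.

(* S^{<= n}, for S generating H *)
Definition word_ball (G : groupType) (H S : set G) (n : nat) : set G :=
  [set h | H h /\ (word_dist S 1%g h <= n)%N].

(** ** Displacement and loxodromic isometries *)

(* Distances being nonnegative, the default value 0 only matters for S = set0. *)
Definition joint_displacement_at (R : realType) (X : metricType R)
    (S : set (isometry_of X)) (x : X) : R :=
  \big[Num.max/0]_(s <- fset_set S) mdist x (s x).

Definition joint_displacement (R : realType) (X : metricType R)
    (S : set (isometry_of X)) : R :=
  inf (range (joint_displacement_at S)).

Definition zexpg (G : groupType) (g : G) (n : int) : G :=
  match n with
  | Posz k => (g ^+ k)%g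
  | Negz k => (g ^- k.+1)%g
  end.

Definition qi_embedding_int (R : realType) (X : metricType R) (f : int -> X) :
    Prop :=
  exists K c : R, [/\ 1 <= K, 0 <= c & forall m n : int,
    K^-1 * `|(m - n)%:~R| - c <= mdist (f m) (f n) <= K * `|(m - n)%:~R| + c].

(* The condition does not depend on the base point o. *)
Definition loxodromic (R : realType) (X : metricType R) (g : isometry_of X) :
    Prop :=
  forall o : X, qi_embedding_int (fun n : int => zexpg g n o).

(* Main.v *)
(* Let L be the joint displacement of S, let o almost realise it, and let s in S
   move o by at least L. If x is the point at distance r, slightly more than
   delta, from o on a segment [o, s o], some t in S still moves x by at least L.
   When both t o and t^-1 o follow s o for a length r, thinness makes t move x by
   only d(o, t o) - 2 r + 2 delta < L; so s o diverges from t o or from t^-1 o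
   before length r, and t moves o by at least L - 2 r. Replacing t by its inverse
   if needed, a ping-pong argument shows that one of s, t, s^-1 t satisfies
   d(o, b o) + 2 delta < d(o, b^2 o), which forces b to be loxodromic; each of
   the three moves o by at least L - 2 r. *)

Require Import Defs.
From mathcomp Require Import all_boot all_order all_algebra.
From mathcomp Require Import boolp classical_sets cardinality reals.
From mathcomp Require Import metric_structure.
From mathcomp Require Import lra zify.

Set Implicit Arguments.
Unset Strict Implicit.
Unset Printing Implicit Defensive.

Import Order.TTheory GRing.Theory Num.Theory.
Local Open Scope classical_set_scope.
Local Open Scope ring_scope.

Section hyperbolic.
Context {R : realType} {X : metricType R}.
Implicit Types (x y z o : X) (g s t : isometry_of X).

(** * Gromov products and geodesics *)

Lemma gromov_productC x y o : gromov_product x y o = gromov_product y x o.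
Proof. by rewrite /gromov_product (metric_sym y x) [mdist y o + _]addrC. Qed.

Lemma gromov_product_ge0 x y o : 0 <= gromov_product x y o.
Proof.
have := metric_triangle x o y; rewrite (metric_sym o y) /gromov_product; lra.
Qed.

Lemma gromov_product_lel x y o : gromov_product x y o <= mdist o x.
Proof.
have := metric_triangle y x o; rewrite (metric_sym y x) (metric_sym o x).
by rewrite /gromov_product; lra.
Qed.

Lemma gromov_product_ler x y o : gromov_product x y o <= mdist o y.
Proof. by rewrite gromov_productC gromov_product_lel. Qed.

Lemma geodesic_mdistl x y c u : is_geodesic x y c ->
  0 <= u <= mdist x y -> mdist x (c u) = u.
Proof.
case=> cx _ ciso uI; have /andP[u0 ud] := uI.
rewrite -{1}cx ciso ?in_itv /= ?lexx ?mdist_ge0 //.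
by rewrite sub0r normrN ger0_norm.
Qed.

Lemma geodesic_mdistr x y c u : is_geodesic x y c ->
  0 <= u <= mdist x y -> mdist (c u) y = mdist x y - u.
Proof.
case=> _ cy ciso uI; have /andP[u0 ud] := uI.
rewrite -{1}cy ciso ?in_itv /= ?lexx ?mdist_ge0 //.
by rewrite distrC ger0_norm // subr_ge0.
Qed.

Lemma geodesic_exists x y : geodesic_space X -> exists c, is_geodesic x y c.
Proof. by move=> /(_ x y)[A [c]]; exists c. Qed.

(** Reversing [o, t o] and translating it by t^-1 gives a segment issuing from o, which thinness can
    compare with others. *)
Lemma geodesic_backward t o c : is_geodesic o (t o) c ->
  is_geodesic o (t^-1%g o) (fun u => t^-1%g (c (mdist o (t o) - u))).
Proof.
have dV : mdist o (t^-1%g o) = mdist o (t o).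
  by rewrite -(isom_mdist t) isomVK metric_sym.
case=> c0 c1 ciso; split; rewrite ?dV.
- by rewrite subr0 c1 isomKV.
- by rewrite subrr c0.
- move=> u v uI vI; rewrite isom_mdist; move: uI vI.
  rewrite !in_itv /= => /andP[u0 u1] /andP[v0 v1].
  rewrite ciso ?in_itv /=; [|by apply/andP; split; lra..].
  by rewrite distrC; congr (`|_|); lra.
Qed.

Context (delta : R) (X_hyp : hyperbolic_space X delta).

(** * Thin triangles and the four-point inequality *)

Lemma thin_geodesics o x y c c' u :
  is_geodesic o x c -> is_geodesic o y c' ->
  0 <= u <= gromov_product x y o -> mdist (c u) (c' u) <= delta.
Proof.
move=> cg c'g /andP[u0 uxy].
have ux := le_trans uxy (gromov_product_lel x y o).
have uy := le_trans uxy (gromov_product_ler x y o).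
have cu : mdist o (c u) = u by apply: geodesic_mdistl cg _; rewrite u0.
have c'u : mdist o (c' u) = u by apply: geodesic_mdistl c'g _; rewrite u0.
apply: (X_hyp.2 o x y (c @` `[0, mdist o x]) (c' @` `[0, mdist o y])).
- by exists c.
- by exists c'.
- by exists u => //=; rewrite in_itv /= u0.
- by exists u => //=; rewrite in_itv /= u0.
- by rewrite cu c'u.
- by rewrite cu.
Qed.

Context (delta_ge0 : 0 <= delta).

Lemma gromov_product_hyperbolic u o x y z :
  u <= gromov_product x y o -> u <= gromov_product y z o ->
  u - delta <= gromov_product x z o.
Proof.
move=> uxy uyz; have [u0|u0] := ltP u 0.
  have := gromov_product_ge0 x z o; have := delta_ge0; lra.
have [c cg] := geodesic_exists o x X_hyp.1.
have [c' c'g] := geodesic_exists o y X_hyp.1.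
have [c'' c''g] := geodesic_exists o z X_hyp.1.
have ux := le_trans uxy (gromov_product_lel x y o).
have uz := le_trans uyz (gromov_product_ler y z o).
have xy : mdist (c u) (c' u) <= delta.
  by apply: thin_geodesics cg c'g _; rewrite u0.
have yz : mdist (c' u) (c'' u) <= delta.
  by apply: thin_geodesics c'g c''g _; rewrite u0.
have xu : mdist (c u) x = mdist o x - u.
  by apply: geodesic_mdistr cg _; rewrite u0.
have zu : mdist (c'' u) z = mdist o z - u.
  by apply: geodesic_mdistr c''g _; rewrite u0.
have := metric_triangle x (c u) z; have := metric_triangle (c u) (c'' u) z.
have := metric_triangle (c u) (c' u) (c'' u).
rewrite /gromov_product (metric_sym x (c u)) (metric_sym x o) (metric_sym z o).
lra.
Qed.

(** Seen from x, this is [gromov_product_hyperbolic] with u the smaller of the products of y, z and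
    of z, w. *)
Lemma four_point x y z w :
  mdist x z + mdist y w <=
    Num.max (mdist x y + mdist z w) (mdist x w + mdist y z) + 2 * delta.
Proof.
set M := Num.max _ _.
have [M1 M2] : mdist x y + mdist z w <= M /\ mdist x w + mdist y z <= M.
  by rewrite /M !le_max !lexx orbT.
have [le|/ltW le] := leP (gromov_product y z x) (gromov_product z w x).
  have := gromov_product_hyperbolic (lexx _) le.
  by rewrite /gromov_product !(metric_sym _ x); lra.
have := gromov_product_hyperbolic le (lexx _).
by rewrite /gromov_product !(metric_sym _ x); lra.
Qed.

(** * Growth of orbits and loxodromic isometries *)

Lemma mdist_expg g o m n :
  mdist ((g ^+ m)%g o) ((g ^+ (m + n))%g o) = mdist o ((g ^+ n)%g o).
Proof. by rewrite expgnDr isomME isom_mdist. Qed.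

Lemma mdist_expg_le g o n : mdist o ((g ^+ n)%g o) <= n%:R * mdist o (g o).
Proof.
elim: n => [|n IHn]; first by rewrite expg0 mul0r isom1E mdistxx.
apply: le_trans (metric_triangle _ ((g ^+ n)%g o) _) _.
by rewrite -addn1 mdist_expg expg1 natrD mulrDl mul1r lerD2r.
Qed.

(* Applying the four-point inequality to o, g o, g^2 o, g^(n+1) o shows that the
   sequence d(o, g^n o) grows by at least [eta] at each step. *)
Lemma mdist_expg_grows g o eta : 0 < eta ->
  mdist o (g o) + 2 * delta + eta <= mdist o ((g * g)%g o) ->
  forall n, mdist o ((g ^+ n.+1)%g o) + eta <= mdist o ((g ^+ n.+2)%g o).
Proof.
move=> eta0 gg; elim=> [|n IHn].
  by rewrite expg1 expgSr expg1; have := delta_ge0; lra.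
set a := fun k => mdist o ((g ^+ k)%g o).
have : a 2%N + a n.+2 <= Num.max (a 1%N + a n.+1) (a n.+3 + a 1%N) + 2 * delta.
  have := four_point o ((g ^+ 1)%g o) ((g ^+ 2)%g o) ((g ^+ n.+3)%g o).
  by rewrite -{1}[n.+3]/(1 + n.+2)%N mdist_expg -{1}[n.+3]/(2 + n.+1)%N
    mdist_expg -{2}[2%N]/(1 + 1)%N mdist_expg.
have a1 : a 1%N = mdist o (g o) by rewrite /a expg1.
have a2 : a 2%N = mdist o ((g * g)%g o) by rewrite /a expgSr expg1.
rewrite -/(a n.+3) -/(a n.+2) -/(a n.+1) in IHn *.
(* Were the first term the maximum, [a n.+2 + eta <= a n.+1] would follow, against [IHn]. *)
by have [_|_] := leP (a 1%N + a n.+1) (a n.+3 + a 1%N); lra.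
Qed.

Lemma zexpgDn g (i : int) k : zexpg g (i + k%:Z) = (zexpg g i * g ^+ k)%g.
Proof.
elim: k => [|k IHk]; first by rewrite addr0 expg0 mulg1.
rewrite expgSr mulgA -IHk -addn1 PoszD addrA; case: (i + k%:Z) => [j|[|j]].
- by rewrite -PoszD addn1 /= expgSr.
- by rewrite /= expg1 mulVg.
- have -> : Negz j.+1 + 1%N%:Z = Negz j by rewrite !NegzE; lia.
  by rewrite /= (expgS g j.+1) invgM -mulgA mulVg mulg1.
Qed.

Lemma mdist_zexpg g o (m n : int) :
  mdist (zexpg g m o) (zexpg g n o) = mdist o ((g ^+ `|m - n|%N)%g o).
Proof.
wlog le_nm : m n / n <= m.
  move=> le_case; have [/le_case//|/ltW/le_case] := leP n m.
  by rewrite metric_sym distnC.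
have {1}-> : m = n + `|m - n|%N%:Z by lia.
by rewrite zexpgDn isomME isom_mdist metric_sym.
Qed.

Lemma loxodromic_criterion g o :
  mdist o (g o) + 2 * delta < mdist o ((g * g)%g o) -> loxodromic g.
Proof.
move=> gg o'.
set eta := mdist o ((g * g)%g o) - (mdist o (g o) + 2 * delta).
have eta0 : 0 < eta by rewrite subr_gt0.
(* Growth is known only from exponent 1 on, hence the loss of one [eta]. *)
have lower n : n%:R * eta - eta <= mdist o ((g ^+ n)%g o).
  case: n => [|n].
    by have := mdist_ge0 o ((g ^+ 0)%g o); lra.
  rewrite -natr1 mulrDl mul1r addrK; elim: n => [|n IHn].
    by rewrite mul0r mdist_ge0.
  apply: le_trans (@mdist_expg_grows g o eta eta0 _ n); last by rewrite /eta; lra.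
  by rewrite -natr1 mulrDl mul1r lerD2r.
(* The factor dominates d(o, g o) for the upper bound and [eta^-1] for the lower one; the additive
   constant absorbs the lost [eta] and the change of base point. *)
exists (1 + mdist o (g o) + eta^-1), (eta + 2 * mdist o o').
have g0 := mdist_ge0 o (g o); have o0 := mdist_ge0 o o'.
have eV0 : 0 < eta^-1 by rewrite invr_gt0.
split; [lra|lra|] => m n.
have near : `|mdist (zexpg g m o') (zexpg g n o') -
    mdist (zexpg g m o) (zexpg g n o)| <= 2 * mdist o o'.
  have := metric_triangle (zexpg g m o') (zexpg g m o) (zexpg g n o').
  have := metric_triangle (zexpg g m o) (zexpg g n o) (zexpg g n o').
  have := metric_triangle (zexpg g m o) (zexpg g m o') (zexpg g n o).
  have := metric_triangle (zexpg g m o') (zexpg g n o') (zexpg g n o).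
  rewrite ?(metric_sym (zexpg g _ o') (zexpg g _ o)) !isom_mdist.
  by rewrite ler_norml; lra.
move: near; rewrite (mdist_zexpg g o) ler_norml => /andP[].
have -> : `|(m - n)%:~R| = (`|m - n|%N)%:R :> R by rewrite -intr_norm -abszE.
set k := `|m - n|%N; have := lower k; have := mdist_expg_le g o k.
move=> up lo near1 near2.
have k0 : 0 <= k%:R :> R by [].
have Ke : (1 + mdist o (g o) + eta^-1)^-1 * k%:R <= k%:R * eta.
  rewrite mulrC ler_wpM2l // -[leRHS]invrK lef_pV2 ?posrE; lra.
have Kk : k%:R * mdist o (g o) <= (1 + mdist o (g o) + eta^-1) * k%:R.
  rewrite mulrC ler_wpM2r //; lra.
by apply/andP; split; lra.
Qed.

(** * Folding at a point and ping-pong *)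

(** Hence the product of g o and g^-1 o at o is d(o, g o) - d(o, g^2 o) / 2: it is large exactly
    when g folds back. *)
Lemma mdist_backward_forward g o :
  mdist (g^-1%g o) (g o) = mdist o ((g * g)%g o).
Proof. by rewrite -(isom_mdist g) isomVK isomME. Qed.

Lemma mdist_backward g o : mdist o (g^-1%g o) = mdist o (g o).
Proof. by rewrite -(isom_mdist g) isomVK metric_sym. Qed.

(* If [s] and [t] fold back at [o] while moving it in distinct directions, then
   the segments from [o] to the images under [s^-1 t] and its inverse start along
   [s^-1 o] and [t^-1 o], which have diverged before length [r + 2 delta]. *)
Lemma product_not_folding s t o r : 0 <= r ->
  2 * r + 6 * delta <= mdist o (s o) -> 2 * r + 6 * delta <= mdist o (t o) ->
  mdist o ((s * s)%g o) <= mdist o (s o) + 2 * delta ->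
  mdist o ((t * t)%g o) <= mdist o (t o) + 2 * delta ->
  gromov_product (s o) (t o) o < r ->
  let g := (s^-1 * t)%g in
  mdist o (s o) + mdist o (t o) - 2 * r < mdist o (g o) /\
  mdist o (g o) + 2 * delta < mdist o ((g * g)%g o).
Proof.
move=> r0 sr tr ss tt st g; have d0 := delta_ge0.
have gE : mdist o (g o) = mdist (s o) (t o).
  by rewrite /g isomME -(isom_mdist s) isomVK.
have sg : mdist (s^-1%g o) (g o) = mdist o (t o) by rewrite /g isomME isom_mdist.
have tg : mdist (t^-1%g o) (g^-1%g o) = mdist o (s o).
  by rewrite /g invgM invgK isomME isom_mdist.
have g2 := mdist_backward_forward g o.
have s2 := mdist_backward_forward s o.
have t2 := mdist_backward_forward t o.
have gV := mdist_backward g o; have sV := mdist_backward s o.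
have tV := mdist_backward t o.
have glt : mdist o (s o) + mdist o (t o) - 2 * r < mdist o (g o).
  by move: st; rewrite gE /gromov_product !(metric_sym _ o); lra.
(* Otherwise the chain s o, s^-1 o, t^-1 o, t o, losing [delta] at each of two steps, makes the
   product of s o and t o at least r. *)
have sVtV : gromov_product (s^-1%g o) (t^-1%g o) o < r + 2 * delta.
  rewrite ltNge; apply/negP => le1.
  have le2 : r + 2 * delta <= gromov_product (s o) (s^-1%g o) o.
    rewrite gromov_productC /gromov_product s2 !(metric_sym _ o); lra.
  have le3 : r + 2 * delta - delta <= gromov_product (t^-1%g o) (t o) o.
    rewrite /gromov_product t2 !(metric_sym _ o); lra.
  have := gromov_product_hyperbolic (gromov_product_hyperbolic le2 le1) le3.
  lra.
(* Same argument along s^-1 o, g o, g^-1 o, t^-1 o; the outer products exceed d(o, s o) - r and d(o,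
   t o) - r. *)
have gVg : gromov_product (g o) (g^-1%g o) o < r + 4 * delta.
  rewrite ltNge; apply/negP => le1.
  have le2 : r + 4 * delta <= gromov_product (s^-1%g o) (g o) o.
    by move: st; rewrite /gromov_product sg -gE !(metric_sym _ o); lra.
  have le3 : r + 4 * delta - delta <= gromov_product (g^-1%g o) (t^-1%g o) o.
    move: st; rewrite (gromov_productC (g^-1%g o)) /gromov_product tg -gE !(metric_sym _ o); lra.
  have := gromov_product_hyperbolic (gromov_product_hyperbolic le2 le1) le3.
  lra.
(* It suffices that d(o, g o) >= 2 r + 10 delta, and [glt] gives more than 2 r + 12 delta. *)
split => //; move: gVg.
rewrite gromov_productC /gromov_product g2 !(metric_sym _ o); lra.
Qed.

(** On [o, t o], the point [c r] is near the point at distance r from o, and its image under t is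
    near the point at distance r from t o. *)
Lemma displacement_shift t o p c r : is_geodesic o p c ->
  0 <= r -> 2 * r <= mdist o (t o) ->
  r <= gromov_product p (t o) o -> r <= gromov_product p (t^-1%g o) o ->
  mdist (c r) (t (c r)) <= mdist o (t o) - 2 * r + 2 * delta.
Proof.
move=> cg r0 rt rp rpV.
have [e eg] := geodesic_exists o (t o) X_hyp.1.
have near1 : mdist (c r) (e r) <= delta.
  by apply: thin_geodesics cg eg _; rewrite r0.
have near2 : mdist (c r) (t^-1%g (e (mdist o (t o) - r))) <= delta.
  by apply: (thin_geodesics cg (geodesic_backward eg)); rewrite r0.
move: near2; rewrite -(isom_mdist t) isomVK => near2.
have mid : mdist (e r) (e (mdist o (t o) - r)) = mdist o (t o) - 2 * r.
  case: eg => _ _ ->; rewrite ?in_itv /=; [|by apply/andP; split; lra..].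
  by rewrite distrC ger0_norm; lra.
have := metric_triangle (c r) (e r) (t (c r)).
have := metric_triangle (e r) (e (mdist o (t o) - r)) (t (c r)).
rewrite (metric_sym (e (mdist o (t o) - r))); lra.
Qed.

End hyperbolic.

(** * Attaining the maximum and approaching the infimum of displacements *)

Section joint_displacement.
Context {R : realType} {X : metricType R}.
Implicit Types (S : set (isometry_of X)) (x : X).

Lemma joint_displacement_at_ge0 S x : 0 <= joint_displacement_at S x.
Proof. exact: bigmax_ge_id. Qed.

Lemma le_joint_displacement_at S s x : finite_set S -> S s ->
  mdist x (s x) <= joint_displacement_at S x.
Proof.
move=> Sfin Ss; apply: (le_bigmax_seq 0 s xpredT (fun s => mdist x (s x))) => //.
by rewrite in_fset_set // in_setE.
Qed.

Lemma joint_displacement_le S x :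
  joint_displacement S <= joint_displacement_at S x.
Proof.
apply: ge_inf; last by exists x.
by exists 0 => _ [y _ <-]; exact: joint_displacement_at_ge0.
Qed.

Lemma exists_displacement_ge S x : finite_set S -> 0 < joint_displacement S ->
  exists2 s, S s & joint_displacement S <= mdist x (s x).
Proof.
move=> Sfin L0; apply: contrapT => noS.
have := joint_displacement_le S x; rewrite leNgt => /negP; apply.
(* The default value 0 of the maximum is also below the joint displacement, by [L0]. *)
rewrite /joint_displacement_at big_seq; apply: bigmax_lt => // s.
rewrite in_fset_set // in_setE => Ss; rewrite ltNge; apply/negP => Ls.
by apply: noS; exists s.
Qed.

Lemma joint_displacement_near S e : 0 < joint_displacement S -> 0 < e ->
  exists x, joint_displacement_at S x < joint_displacement S + e.
Proof.
move=> L0 e0.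
have hinf : has_inf (range (joint_displacement_at S)).
  split.
    (* An empty space would give the conventional infimum 0. *)
    apply/set0P/negP => /eqP r0; move: L0.
    by rewrite /joint_displacement r0 inf0 ltxx.
  by exists 0 => _ [y _ <-]; exact: joint_displacement_at_ge0.
by have [_ [x _ <-] ?] := inf_adherent e0 hinf; exists x.
Qed.

End joint_displacement.

(** * Subgroups and words of length at most two *)

Lemma generates_sub {G : groupType} (S H : set G) :
  generates S H -> S `<=` H.
Proof. by move=> <-; exact: sub_smallest. Qed.

Lemma subgroupM {G : groupType} (H : set G) g h :
  subgroup H -> H g -> H h -> H (g * h)%g.
Proof.
move=> [H1 HV] Hg Hh.
have HVh : H h^-1%g.
  by have := HV 1%g h H1; rewrite div1g !in_setE; apply.
by have := HV g h^-1%g; rewrite invgK !in_setE; apply.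
Qed.

Lemma word_dist_le {G : groupType} (S : set G) n g :
  is_word S n g -> (word_dist S 1%g g <= n)%N.
Proof.
move=> Sng; rewrite /word_dist invg1 mul1g; case: pselect => // ex.
by case: ex_minnP => m _; apply; apply/asboolP.
Qed.

Lemma is_word1 {G : groupType} (S : set G) s : S s -> is_word S 1 s.
Proof.
move=> Ss; exists [tuple s]; split; last by rewrite big_seq1.
by move=> x; rewrite inE => /eqP ->.
Qed.

Lemma is_word2 {G : groupType} (S : set G) s t :
  S s -> S t -> is_word S 2 (s * t)%g.
Proof.
move=> Ss St; exists [tuple s; t]; split; last by rewrite big_cons big_seq1.
by move=> x; rewrite !inE => /orP[] /eqP ->.
Qed.

Theorem lemma3p2 (R : realType) (delta : R) (delta_ge0 : 0 <= delta) :
  exists C : R, 0 < C /\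
    forall X : metricType R, hyperbolic_space X delta ->
    forall H S : set (isometry_of X),
      subgroup H -> finite_set S -> symmetric_set S -> generates S H ->
      28 * delta < joint_displacement S ->
    exists b : isometry_of X,
      [/\ H b, word_ball H S 2 b, loxodromic b &
        exists o : X, joint_displacement S - C <= mdist o (b o)].
Proof.
(* The bound reached is L - 2 r, where 2 r = 2 delta + 2 e and e <= 1. *)
exists (2 * delta + 3); split=> [|X X_hyp H S Hgrp Sfin Ssym genSH]; first lra.
set L := joint_displacement S => L28.
have L0 : 0 < L by lra.
(* The second term ensures L >= 28 delta + 4 e, which exceeds the 4 r + 6 delta needed for
   [product_not_folding]. *)
pose e := Num.min 1 ((L - 28 * delta) / 4).
have e0 : 0 < e by rewrite lt_min ltr01 /=; lra.
have [e1 eL] : e <= 1 /\ e <= (L - 28 * delta) / 4.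
  by rewrite /e !ge_min !lexx orbT.
clearbody e; pose r := delta + e.
have r0 : 0 <= r by rewrite /r; lra.
have [o oL] := @joint_displacement_near R X S e L0 e0.
have moves t : S t -> mdist o (t o) < L + e.
  by move=> St; apply: le_lt_trans oL; exact: le_joint_displacement_at.
have SH := generates_sub genSH.
have done1 b : H b -> word_ball H S 2 b -> L - 2 * r <= mdist o (b o) ->
    mdist o (b o) + 2 * delta < mdist o ((b * b)%g o) ->
    exists b : isometry_of X, [/\ H b, word_ball H S 2 b, loxodromic b &
      exists o : X, L - (2 * delta + 3) <= mdist o (b o)].
  move=> Hb Wb Lb bb; exists b; split => //.
    exact: (loxodromic_criterion X_hyp delta_ge0 bb).
  by exists o; rewrite /r in Lb; lra.
have done_S s : S s -> L - 2 * r <= mdist o (s o) ->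
    mdist o (s o) + 2 * delta < mdist o ((s * s)%g o) -> _ :=
  fun Ss => @done1 s (SH s Ss)
    (conj (SH s Ss) (leq_trans (word_dist_le (is_word1 Ss)) (leqnSn 1))).
have [s Ss Ls] := exists_displacement_ge o Sfin L0.
have [ss|ss] := ltP (mdist o (s o) + 2 * delta) (mdist o ((s * s)%g o)).
  by apply: (done_S s) => //; rewrite /r; lra.
(* Stated for any t, to serve for both an element of S and its inverse. *)
have diverging t : S t -> L - 2 * r <= mdist o (t o) ->
    gromov_product (s o) (t o) o < r ->
    exists b : isometry_of X, [/\ H b, word_ball H S 2 b, loxodromic b &
      exists o : X, L - (2 * delta + 3) <= mdist o (b o)].
  move=> St Lt st.
  have [tt|tt] := ltP (mdist o (t o) + 2 * delta) (mdist o ((t * t)%g o)).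
    exact: (done_S t).
  have sr : 2 * r + 6 * delta <= mdist o (s o) by rewrite /r; lra.
  have tr : 2 * r + 6 * delta <= mdist o (t o) by move: Lt; rewrite /r; lra.
  have [gL gg] := product_not_folding X_hyp delta_ge0 r0 sr tr ss tt st.
  have SV := Ssym _ Ss.
  have Hst : H (s^-1 * t)%g by apply: subgroupM => //; apply: SH.
  apply: (done1 (s^-1 * t)%g) => //.
    by split=> //; apply: word_dist_le; exact: is_word2.
  by move: Lt gL; rewrite /r; lra.
have [c cg] := geodesic_exists o (s o) X_hyp.1.
have [t St Lt] := exists_displacement_ge (c r) Sfin L0.
have cr : mdist o (c r) = r.
  by apply: (geodesic_mdistl cg); rewrite /r; lra.
have Lto : L - 2 * r <= mdist o (t o).
  have := metric_triangle (c r) o (t (c r)).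
  have := metric_triangle o (t o) (t (c r)).
  by rewrite isom_mdist (metric_sym (c r) o) cr; move: Lt; rewrite /L; lra.
have [stV|stV] := ltP (gromov_product (s o) (t^-1%g o) o) r.
  by apply: (diverging t^-1%g) => //; [exact: Ssym|rewrite mdist_backward].
have [st|st] := ltP (gromov_product (s o) (t o) o) r.
  exact: (diverging t).
have rt : 2 * r <= mdist o (t o) by move: Lto; rewrite /r; lra.
(* Now t moves [c r] by less than (L + e) - 2 r + 2 delta = L - e, a contradiction. *)
have := displacement_shift X_hyp cg r0 rt st stV.
by have := moves t St; move: Lt; rewrite -/L /r; lra.
Qed.
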